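(* The entire family of integral triangles $ABC$ with $\angle B = 2\angle A$ and with the angle bisector $\overline{BD}$ of the angle at $B$ also of integral length $r=|\overline{BD}|$ is parametrically described by $$b=dkm^2,\quad a=dmk^2,\quad c=dm(m^2-k^2),\quad r=|\overline{BD}|=|\overline{AD}|=dk(m^2-k^2),\quad |\overline{DC}|=dk^3,$$ where $d,k,m$ are positive integers with $k$ and $m$ relatively prime and with either $k^2<m^2\le 2k^2$ or $2k^2<m^2<4k^2$. That is: (i) for every integral triangle $ABC$ with $\angle B=2\angle A$ and $|\overline{BD}|$ an integer, there exist such integers $d,k,m$ for which all the displayed formulas hold; and (ii) for all such integers $d,k,m$ there exists an integral triangle $ABC$ with $\angle B=2\angle A$ and $|\overline{BD}|$ an integer, for which all the displayed formulas hold.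
   Context: Triangles are non-degenerate triangles in the Euclidean plane. An integral triangle is a triangle all three of whose side lengths are integers. For a triangle $ABC$, write $a=|\overline{BC}|$, $b=|\overline{CA}|$, $c=|\overline{AB}|$ for the side lengths, and $\angle A$, $\angle B$ for the interior angles at $A$ and $B$. The point $D$ is the point of the side $\overline{AC}$ at which the internal bisector of the angle at $B$ meets that side, so the angle bisector is the segment $\overline{BD}$. *)

(* Defs.v *)
(* Concrete real numbers of the standard library; the plane is R * R. *)
From Stdlib Require Import Reals ZArith.

Open Scope R_scope.

Definition point : Type := (R * R)%type.

Definition pdist (P Q : point) : R :=
  dist_euc (fst P) (snd P) (fst Q) (snd Q).

(* Inner product of the vectors from Q to P and from Q to S. *)
Definition dot_at (P Q S : point) : R :=
  (fst P - fst Q) * (fst S - fst Q) + (snd P - snd Q) * (snd S - snd Q).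

(* Unoriented angle PQS at the vertex Q, in [0, PI]; only meaningful when
   P and S both differ from Q. *)
Definition angle (P Q S : point) : R :=
  acos (dot_at P Q S / (pdist Q P * pdist Q S)).

(* Nondegenerate: twice the signed area is nonzero. *)
Definition triangle (A B C : point) : Prop :=
  (fst B - fst A) * (snd C - snd A) - (fst C - fst A) * (snd B - snd A) <> 0.

Definition is_integer (x : R) : Prop := exists z : Z, x = IZR z.

Definition integral_triangle (A B C : point) : Prop :=
  triangle A B C /\
  is_integer (pdist B C) /\ is_integer (pdist C A) /\ is_integer (pdist A B).

Definition on_segment (P Q X : point) : Prop :=
  exists t : R, 0 <= t <= 1 /\
    X = ((1 - t) * fst P + t * fst Q, (1 - t) * snd P + t * snd Q).

(* D is the point where the bisector of the angle at B meets the side AC.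
   As D lies between A and C, equality of the two unoriented angles singles
   out the internal bisector. *)
Definition bisector_foot (A B C D : point) : Prop :=
  on_segment A C D /\ angle A B D = angle D B C.

Definition integral_bisected_triangle (A B C D : point) : Prop :=
  integral_triangle A B C /\
  angle A B C = 2 * angle B A C /\
  bisector_foot A B C D /\
  is_integer (pdist B D).

Definition admissible (d k m : Z) : Prop :=
  (0 < d /\ 0 < k /\ 0 < m /\ Z.gcd k m = 1 /\
   ((k ^ 2 < m ^ 2 /\ m ^ 2 <= 2 * k ^ 2) \/
    (2 * k ^ 2 < m ^ 2 /\ m ^ 2 < 4 * k ^ 2)))%Z.

Definition parametrized (A B C D : point) (d k m : Z) : Prop :=
  pdist C A = IZR (d * k * m ^ 2) /\
  pdist B C = IZR (d * m * k ^ 2) /\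
  pdist A B = IZR (d * m * (m ^ 2 - k ^ 2)) /\
  pdist B D = IZR (d * k * (m ^ 2 - k ^ 2)) /\
  pdist A D = IZR (d * k * (m ^ 2 - k ^ 2)) /\
  pdist D C = IZR (d * k ^ 3).

(* Main.v *)
From Stdlib Require Import Reals ZArith Lra Lia.
Require Import Defs.

(** By the law of cosines, [angle B = 2 * angle A] amounts to
    [b^2 = a * (a + c)]: the polynomial identity [cos B = 2 (cos A)^2 - 1] has
    the only other root [b^2 = (c - a)^2], which is degenerate.  Writing
    [a = g k] and [b = g m] in lowest terms, [k] divides [g], so
    [a = e k^2], [b = e k m], [c = e (m^2 - k^2)].  The foot of the bisector
    divides [AC] in the ratio [c : a], whence [r = b c / (a + c)] and
    [r m = e k (m^2 - k^2)]; by coprimality [m] divides [e].  Conversely the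
    triangle is realized with [cos A = m / (2 k)]. *)

(** * Distances, angles and the law of cosines in coordinates *)

Lemma pdist_sqr P Q :
  pdist P Q ^ 2 = (fst P - fst Q) ^ 2 + (snd P - snd Q) ^ 2.
Proof.
unfold pdist, dist_euc.
rewrite pow2_sqrt; [unfold Rsqr; ring|].
apply Rplus_le_le_0_compat; apply Rle_0_sqr.
Qed.

Lemma pdist_ge0 P Q : 0 <= pdist P Q.
Proof. apply sqrt_pos. Qed.

Lemma pdist_sym P Q : pdist P Q = pdist Q P.
Proof. apply distance_symm. Qed.

Lemma sqr_inj_nonneg x y : 0 <= x -> 0 <= y -> x ^ 2 = y ^ 2 -> x = y.
Proof. intros; nra. Qed.

Lemma pdist_eq P Q l :
  0 <= l -> (fst P - fst Q) ^ 2 + (snd P - snd Q) ^ 2 = l ^ 2 -> pdist P Q = l.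
Proof.
intros Hl H; apply sqr_inj_nonneg; [apply pdist_ge0|exact Hl|].
now rewrite pdist_sqr.
Qed.

Lemma law_of_cosines P Q S :
  dot_at P Q S = (pdist Q P ^ 2 + pdist Q S ^ 2 - pdist P S ^ 2) / 2.
Proof. rewrite !pdist_sqr; unfold dot_at; field. Qed.

(** Twice the signed area of the triangle. Up to sign it does not depend on which vertex serves as
    origin, so [triangle A B C] makes it nonzero at every vertex. *)
Definition cross_at (P Q S : point) : R :=
  (fst P - fst Q) * (snd S - snd Q) - (fst S - fst Q) * (snd P - snd Q).

Lemma lagrange_identity P Q S :
  dot_at P Q S ^ 2 + cross_at P Q S ^ 2 = (pdist Q P * pdist Q S) ^ 2.
Proof. rewrite Rpow_mult_distr, !pdist_sqr; unfold dot_at, cross_at; ring. Qed.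

Lemma cross_at_pdist_gt0 P Q S :
  cross_at P Q S <> 0 -> 0 < pdist Q P /\ 0 < pdist Q S.
Proof.
intros H.
assert (L := lagrange_identity P Q S).
assert (0 < cross_at P Q S ^ 2) by nra.
assert (HP := pdist_ge0 Q P); assert (HS := pdist_ge0 Q S).
split; [destruct HP as [HP|HP]|destruct HS as [HS|HS]]; auto;
  [rewrite <- HP in L|rewrite <- HS in L]; nra.
Qed.

(** Strict Cauchy-Schwarz: in the Lagrange identity the remainder [cross_at P Q S ^ 2] is
    positive. *)
Lemma dot_at_lt P Q S :
  cross_at P Q S <> 0 -> Rabs (dot_at P Q S) < pdist Q P * pdist Q S.
Proof.
intros H.
assert (L := lagrange_identity P Q S).
destruct (cross_at_pdist_gt0 _ _ _ H) as [HP HS].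
assert (0 < pdist Q P * pdist Q S) by nra.
assert (0 < cross_at P Q S ^ 2) by nra.
apply Rabs_def1; nra.
Qed.

(** By the law of cosines, strict Cauchy-Schwarz places [pdist P S ^ 2] strictly between the squares
    of the difference and of the sum of the other two sides. *)
Lemma triangle_inequality_strict P Q S :
  cross_at P Q S <> 0 ->
  pdist P S < pdist Q P + pdist Q S /\
  Rabs (pdist Q P - pdist Q S) < pdist P S.
Proof.
intros H.
assert (L := dot_at_lt _ _ _ H).
destruct (Rabs_def2 _ _ L) as [L1 L2].
rewrite law_of_cosines in L1, L2.
destruct (cross_at_pdist_gt0 _ _ _ H) as [HP HS].
assert (HR := pdist_ge0 P S).
split; [nra|apply Rabs_def1; nra].
Qed.

Lemma dot_at_bound P Q S :
  pdist Q P <> 0 -> pdist Q S <> 0 ->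
  -1 <= dot_at P Q S / (pdist Q P * pdist Q S) <= 1.
Proof.
intros HP HS.
assert (L := lagrange_identity P Q S).
assert (H1 := pdist_ge0 Q P); assert (H2 := pdist_ge0 Q S).
assert (0 < pdist Q P * pdist Q S) by (apply Rmult_lt_0_compat; lra).
set (w := pdist Q P * pdist Q S) in *.
assert (0 <= cross_at P Q S ^ 2) by nra.
split; apply Rmult_le_reg_r with w; auto;
  unfold Rdiv; rewrite Rmult_assoc, Rinv_l by lra; nra.
Qed.

Lemma cos_angle P Q S :
  pdist Q P <> 0 -> pdist Q S <> 0 ->
  cos (angle P Q S) = dot_at P Q S / (pdist Q P * pdist Q S).
Proof. intros HP HS; apply cos_acos, dot_at_bound; auto. Qed.

(** As [x] is nonnegative, [acos x] is at most [PI / 2], so its double stays in the range where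
    [acos] inverts [cos]. *)
Lemma acos_double x : 0 <= x <= 1 -> acos (2 * x ^ 2 - 1) = 2 * acos x.
Proof.
intros Hx.
assert (B := acos_bound x).
assert (C : cos (acos x) = x) by (apply cos_acos; lra).
assert (acos x <= PI / 2).
{ destruct (Rle_or_lt (acos x) (PI / 2)) as [|N]; auto.
  assert (cos (acos x) < 0) by (apply cos_lt_0; assert (P := PI_RGT_0); lra).
  lra. }
rewrite <- (acos_cos (2 * acos x)) by lra.
f_equal; rewrite cos_2a_cos, C; ring.
Qed.

(** * Metric consequences of the angle conditions *)

Lemma double_angle_sides A B C :
  triangle A B C -> angle A B C = 2 * angle B A C ->
  pdist C A ^ 2 = pdist B C * (pdist B C + pdist A B).
Proof.
intros T H.
assert (XB : cross_at A B C <> 0) by (unfold triangle, cross_at in *; lra).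
assert (XA : cross_at B A C <> 0) by (unfold triangle, cross_at in *; lra).
destruct (cross_at_pdist_gt0 _ _ _ XB) as [PA PC].
destruct (cross_at_pdist_gt0 _ _ _ XA) as [_ PB].
destruct (triangle_inequality_strict _ _ _ XB) as [_ D].
apply (f_equal cos) in H.
rewrite cos_2a_cos, !cos_angle, !law_of_cosines in H
  by (rewrite 1?(pdist_sym A B); lra).
rewrite (pdist_sym A B), (pdist_sym C A) in *.
set (a := pdist B C) in *; set (b := pdist A C) in *;
  set (c := pdist B A) in *.
(* Multiplying the cosine identity by [2 * a * b ^ 2 * c ^ 2] clears its denominators; the resulting
   polynomial splits into these three factors. *)
assert (E : (a + c) * (b ^ 2 - a * (a + c)) * (b ^ 2 - (c - a) ^ 2) = 0).
{ apply (f_equal (fun x => x * (2 * a * b ^ 2 * c ^ 2))) in H.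
  match type of H with ?l = ?r =>
    assert (H1 : l = c * (b ^ 2 * (c ^ 2 + a ^ 2 - b ^ 2))) by (field; lra);
    assert (H2 : r = a * (c ^ 2 + b ^ 2 - a ^ 2) ^ 2 - 2 * a * b ^ 2 * c ^ 2)
      by (field; lra)
  end.
  rewrite H1, H2 in H; clear H1 H2.
  nra. }
destruct (Rabs_def2 _ _ D).
(* The strict triangle inequality [|c - a| < b] excludes the degenerate root. *)
assert (b ^ 2 - (c - a) ^ 2 <> 0) by nra.
apply Rmult_integral in E as [E|E]; [|lra].
apply Rmult_integral in E as [E|E]; lra.
Qed.

(** Here [t] is the position of [D] from [A] towards [C]. Comparing the cosines of the two half
    angles gives the angle bisector theorem; the formula for [pdist B D ^ 2] is Stewart's
    theorem. *)
Lemma bisector_foot_ratio A B C D :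
  triangle A B C -> bisector_foot A B C D ->
  exists t, (pdist B C + pdist A B) * t = pdist A B /\
    pdist A D = t * pdist C A /\ pdist D C = (1 - t) * pdist C A /\
    pdist B D ^ 2 =
      (1 - t) * pdist A B ^ 2 + t * pdist B C ^ 2
      - t * (1 - t) * pdist C A ^ 2.
Proof.
intros T [(t & Ht & HD) H].
assert (XB : cross_at A B C <> 0) by (unfold triangle, cross_at in *; lra).
destruct (cross_at_pdist_gt0 _ _ _ XB) as [PA PC].
assert (HBD : pdist B D ^ 2 =
      (1 - t) * pdist A B ^ 2 + t * pdist B C ^ 2
      - t * (1 - t) * pdist C A ^ 2).
{ rewrite !pdist_sqr, HD; simpl; ring. }
exists t; split; [|split; [|split; [|exact HBD]]].
(* The half angles are meaningful only if [D] differs from [B]; otherwise [B] would lie on the line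
   [AC]. *)
- assert (PD : pdist B D <> 0).
  { intros Z.
    assert (ZS := pdist_sqr B D); rewrite Z, HD in ZS; simpl in ZS.
    apply XB; unfold cross_at.
    set (x := fst B - ((1 - t) * fst A + t * fst C)) in *.
    set (y := snd B - ((1 - t) * snd A + t * snd C)) in *.
    assert (x = 0) by nra; assert (y = 0) by nra.
    unfold x, y in *.
    replace (fst B) with ((1 - t) * fst A + t * fst C) by lra.
    replace (snd B) with ((1 - t) * snd A + t * snd C) by lra.
    ring. }
  apply (f_equal cos) in H.
  rewrite !cos_angle in H by lra.
  assert (D1 : dot_at A B D =
            (1 - t) * pdist B A ^ 2 + t * dot_at A B C).
  { rewrite pdist_sqr; unfold dot_at; rewrite HD; simpl; ring. }
  assert (D2 : dot_at D B C =
            (1 - t) * dot_at A B C + t * pdist B C ^ 2).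
  { rewrite pdist_sqr; unfold dot_at; rewrite HD; simpl; ring. }
  rewrite D1, D2 in H.
  destruct (Rabs_def2 _ _ (dot_at_lt _ _ _ XB)) as [L _].
  rewrite (pdist_sym A B).
  set (a := pdist B C) in *; set (c := pdist B A) in *;
    set (r := pdist B D) in *; set (u := dot_at A B C) in *.
  assert (E : a * ((1 - t) * c ^ 2 + t * u) = c * ((1 - t) * u + t * a ^ 2)).
  { apply (f_equal (fun x => x * (a * c * r))) in H.
    transitivity (((1 - t) * c ^ 2 + t * u) / (c * r) * (a * c * r));
      [field; lra|].
    rewrite H; field; lra. }
  (* [E] amounts to [(c * a - u) * (c - t * (a + c)) = 0], and the first factor is positive by
     strict Cauchy-Schwarz. *)
  apply Rmult_eq_reg_l with (c * a - u); [|lra].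
  nra.
- apply pdist_eq; [apply Rmult_le_pos; [lra|apply pdist_ge0]|].
  rewrite Rpow_mult_distr, pdist_sqr, HD; simpl; ring.
- apply pdist_eq; [apply Rmult_le_pos; [lra|apply pdist_ge0]|].
  rewrite Rpow_mult_distr, pdist_sqr, HD; simpl; ring.
Qed.

(** Geometrically, [ABD] is isosceles because half of the angle at [B] equals the angle at [A].
    Algebraically, inserting [b ^ 2 = a * (a + c)] into Stewart's formula turns it into
    [(t * b) ^ 2]. *)
Lemma double_angle_bisector A B C D :
  triangle A B C -> angle A B C = 2 * angle B A C -> bisector_foot A B C D ->
  (pdist B C + pdist A B) * pdist B D = pdist C A * pdist A B /\
  pdist A D = pdist B D /\ pdist D C = pdist C A - pdist B D.
Proof.
intros T H F.
assert (S := double_angle_sides _ _ _ T H).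
destruct (bisector_foot_ratio _ _ _ _ T F) as (t & Et & E1 & E2 & E3).
assert (XB : cross_at A B C <> 0) by (unfold triangle, cross_at in *; lra).
destruct (cross_at_pdist_gt0 _ _ _ XB) as [PA PC].
rewrite (pdist_sym B A) in PA.
assert (HB : pdist B D = t * pdist C A).
{ rewrite <- E1; apply sqr_inj_nonneg; try apply pdist_ge0.
  rewrite E3, E1, Rpow_mult_distr, S.
  remember (pdist B C + pdist A B) as s eqn:Es.
  assert (Ea : pdist B C = s * (1 - t)) by lra.
  rewrite Ea, <- Et; ring. }
rewrite E1, E2, HB; split; [rewrite <- Et at 2; ring|split; ring].
Qed.

(** * Integer divisibility: from side lengths to parameters *)

Lemma IZR_sqr z : IZR (z ^ 2) = IZR z ^ 2.
Proof. symmetry; exact (pow_IZR z 2). Qed.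

Lemma IZR_cube z : IZR (z ^ 3) = IZR z ^ 3.
Proof. symmetry; exact (pow_IZR z 3). Qed.

Lemma bisected_sides_param (a b c r : Z) :
  (0 < a)%Z -> (0 < b)%Z -> (0 < c)%Z ->
  (b ^ 2 = a * (a + c))%Z -> ((a + c) * r = b * c)%Z ->
  exists d k m : Z, (0 < d /\ 0 < k /\ 0 < m /\ Z.gcd k m = 1 /\
    b = d * k * m ^ 2 /\ a = d * m * k ^ 2 /\ c = d * m * (m ^ 2 - k ^ 2) /\
    r = d * k * (m ^ 2 - k ^ 2))%Z.
Proof.
intros Pa Pb Pc S R.
assert (Hg : (0 < Z.gcd a b)%Z).
{ assert (0 <= Z.gcd a b)%Z by apply Z.gcd_nonneg.
  assert (Z.gcd a b <> 0)%Z by (intros Z; apply Z.gcd_eq_0_l in Z; lia).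
  lia. }
destruct (Z.gcd_divide_l a b) as [k Ek].
destruct (Z.gcd_divide_r a b) as [m Em].
assert (G : Z.gcd k m = 1%Z).
{ replace k with (a / Z.gcd a b)%Z
    by (rewrite Ek at 1; apply Z.div_mul; lia).
  replace m with (b / Z.gcd a b)%Z
    by (rewrite Em at 1; apply Z.div_mul; lia).
  apply Z.gcd_div_gcd; [lia|reflexivity]. }
set (g := Z.gcd a b) in *.
assert (Pk : (0 < k)%Z) by nia.
assert (Pm : (0 < m)%Z) by nia.
assert (E1 : (g * m ^ 2 = k * (k * g + c))%Z).
{ apply Z.mul_reg_l with g; [lia|].
  transitivity (b ^ 2)%Z; [rewrite Em; ring|].
  rewrite S; rewrite Ek at 1 2; ring. }
(* By [E1], [k] divides [m * (m * g)]; Gauss's lemma strips the two factors [m]. *)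
assert (Hk : (k | g)%Z).
{ apply Z.gauss with m; [|exact G].
  apply Z.gauss with m; [|exact G].
  exists (k * g + c)%Z; nia. }
destruct Hk as [e Ee].
assert (Pe : (0 < e)%Z) by nia.
rewrite Ee in Ek, Em, E1.
assert (Ec : (c = e * (m ^ 2 - k ^ 2))%Z).
{ apply Z.mul_reg_l with k; [lia|]. nia. }
assert (Er : (m * r = e * (k * (m ^ 2 - k ^ 2)))%Z).
{ apply Z.mul_reg_l with (e * m)%Z; [nia|].
  transitivity ((a + c) * r)%Z; [rewrite Ek, Ec; ring|].
  rewrite R, Ec, Em; ring. }
assert (Gm : Z.gcd m k = 1%Z) by now rewrite Z.gcd_comm.
assert (Hm : (m | e)%Z).
{ assert (m | k * (k * (k * e)))%Z.
  (* The cofactor comes from [Er] in the form [e * k ^ 3 = m * (e * k * m - r)]. *)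
  { exists (e * k * m - r)%Z; nia. }
  do 3 (apply Z.gauss with k; [|exact Gm]).
  assumption. }
destruct Hm as [d Ed].
exists d, k, m.
repeat split; auto; try nia.
Qed.

Lemma integral_bisected_triangle_parametrized A B C D :
  integral_bisected_triangle A B C D ->
  exists d k m : Z, admissible d k m /\ parametrized A B C D d k m.
Proof.
intros ((T & [a Ea] & [b Eb] & [c Ec]) & H & F & [r Er]).
assert (S := double_angle_sides _ _ _ T H).
destruct (double_angle_bisector _ _ _ _ T H F) as (R & EA & ED).
assert (XB : cross_at A B C <> 0) by (unfold triangle, cross_at in *; lra).
assert (XA : cross_at B A C <> 0) by (unfold triangle, cross_at in *; lra).
assert (XC : cross_at A C B <> 0) by (unfold triangle, cross_at in *; lra).
destruct (cross_at_pdist_gt0 _ _ _ XB) as [PA PC].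
destruct (cross_at_pdist_gt0 _ _ _ XA) as [_ PB].
destruct (triangle_inequality_strict _ _ _ XC) as [TI _].
rewrite (pdist_sym B A) in PA; rewrite (pdist_sym A C) in PB;
  rewrite (pdist_sym C B) in TI.
rewrite ?Ea, ?Eb, ?Ec, ?Er in *.
apply lt_IZR in PA, PB, PC.
assert (S' : (b ^ 2 = a * (a + c))%Z).
{ apply eq_IZR; rewrite mult_IZR, plus_IZR, <- S, IZR_sqr; reflexivity. }
assert (R' : ((a + c) * r = b * c)%Z).
{ apply eq_IZR; rewrite !mult_IZR, plus_IZR; exact R. }
rewrite <- plus_IZR in TI; apply lt_IZR in TI.
destruct (bisected_sides_param a b c r) as
  (d & k & m & Pd & Pk & Pm & G & Hb & Ha & Hc & Hr); auto.
exists d, k, m; split.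
- assert (0 < d * m)%Z by nia.
  assert (k ^ 2 < m ^ 2)%Z by nia.
  assert (m < 2 * k)%Z.
  (* Since [m ^ 2 - k ^ 2 = (m - k) * (m + k)], the inequality [c < a + b] is [m - k < k] multiplied
     by [d * m * (m + k)]. *)
  { apply Z.mul_lt_mono_pos_r with (d * m * (m + k))%Z; [nia|].
    rewrite Ha, Hb, Hc in TI; lia. }
  repeat split; auto.
  (* The two alternatives in [admissible] together cover [k ^ 2 < m ^ 2 < 4 * k ^ 2]. *)
  assert (m ^ 2 < 4 * k ^ 2)%Z by nia.
  lia.
- unfold parametrized.
  rewrite EA, ED, Ea, Eb, Ec, Er, <- Ha, <- Hb, <- Hc, <- Hr.
  repeat split.
  rewrite <- minus_IZR; f_equal; rewrite Hb, Hr; ring.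
Qed.

(** * Realization of given parameters by a triangle *)

Lemma angle_of_sides P Q S x :
  pdist Q P <> 0 -> pdist Q S <> 0 ->
  pdist Q P ^ 2 + pdist Q S ^ 2 - pdist P S ^ 2
    = 2 * x * (pdist Q P * pdist Q S) ->
  angle P Q S = acos x.
Proof.
intros HP HS H; unfold angle; f_equal.
rewrite law_of_cosines, H; field; auto.
Qed.

(* [AC] is laid at angle [acos (m / (2 k))] to the horizontal side [AB]. *)
Lemma realize_lengths (d k m : R) :
  0 < d -> 0 < k -> k < m -> m < 2 * k ->
  exists A B C D : point,
    triangle A B C /\ on_segment A C D /\
    pdist C A = d * k * m ^ 2 /\ pdist B C = d * m * k ^ 2 /\
    pdist A B = d * m * (m ^ 2 - k ^ 2) /\
    pdist B D = d * k * (m ^ 2 - k ^ 2) /\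
    pdist A D = d * k * (m ^ 2 - k ^ 2) /\ pdist D C = d * k ^ 3.
Proof.
intros Pd Pk L1 L2.
assert (Pm : 0 < m) by lra.
set (x := m / (2 * k)).
assert (Em : m = 2 * k * x) by (unfold x; field; lra).
assert (X1 : x < 1) by nra.
assert (X0 : 0 < x) by nra.
set (y := sqrt (1 - x ^ 2)).
assert (Y0 : 0 < y) by (apply sqrt_lt_R0; nra).
assert (Y2 : y ^ 2 = 1 - x ^ 2) by (apply pow2_sqrt; nra).
assert (Pmk : 0 < m ^ 2 - k ^ 2) by nra.
set (b := d * k * m ^ 2).
set (c := d * m * (m ^ 2 - k ^ 2)).
set (r := d * k * (m ^ 2 - k ^ 2)).
assert (Pb : 0 < b) by (unfold b; repeat apply Rmult_lt_0_compat; lra || nra).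
assert (Pc : 0 < c) by (unfold c; repeat apply Rmult_lt_0_compat; lra || nra).
assert (Pr : 0 < r) by (unfold r; repeat apply Rmult_lt_0_compat; lra || nra).
assert (Pa : 0 < d * m * k ^ 2) by (repeat apply Rmult_lt_0_compat; lra || nra).
assert (Pe : 0 < d * k ^ 3) by (apply Rmult_lt_0_compat; [lra|apply pow_lt; lra]).
assert (polar : forall s, (s * x) ^ 2 + (s * y) ^ 2 = s ^ 2).
{ intros s; rewrite !Rpow_mult_distr, Y2; ring. }
(* [C] and [D] lie on one ray from [A], in the unit direction [(x, y)], at distances [b] and [r]. *)
exists (0, 0), (c, 0), (b * x, b * y), (r * x, r * y).
split; [|split; [|repeat split; apply pdist_eq; simpl fst; simpl snd; try lra]].
- unfold triangle; simpl.
  assert (0 < c * (b * y)) by (repeat apply Rmult_lt_0_compat; lra).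
  lra.
- exists (r / b); split; [split|].
  + apply Rlt_le, Rdiv_lt_0_compat; auto.
  + apply Rmult_le_reg_r with b; auto.
    unfold Rdiv; rewrite Rmult_assoc, Rinv_l by lra.
    unfold r, b; assert (0 < d * k) by nra; nra.
  + simpl; f_equal; field; lra.
- rewrite !Rminus_0_r; apply polar.
(* The law of cosines at [A]; the substitution [m = 2 * k * x] then makes the claim a polynomial
   identity. The same works for [BD]. *)
- transitivity (c ^ 2 + b ^ 2 * (x ^ 2 + y ^ 2) - 2 * b * c * x); [ring|].
  rewrite Y2; unfold b, c; rewrite Em; ring.
- transitivity (c ^ 2 + r ^ 2 * (x ^ 2 + y ^ 2) - 2 * r * c * x); [ring|].
  rewrite Y2; unfold r, c; rewrite Em; ring.
- transitivity ((r * x) ^ 2 + (r * y) ^ 2); [ring|apply polar].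
- transitivity (((b - r) * x) ^ 2 + ((b - r) * y) ^ 2); [ring|].
  rewrite polar; unfold b, r; ring.
Qed.

(** Once the lengths are realized, the angle conditions follow from the sides alone: with
    [x = m / (2 * k)], the angle at [A] and both halves of the angle at [B] have cosine [x], and the
    whole angle at [B] has cosine [2 * x ^ 2 - 1]. *)
Lemma admissible_realized d k m :
  admissible d k m ->
  exists A B C D : point,
    integral_bisected_triangle A B C D /\ parametrized A B C D d k m.
Proof.
intros (Pd & Pk & Pm & _ & Hkm).
assert (L1 : (k < m)%Z) by nia.
assert (L2 : (m < 2 * k)%Z) by nia.
clear Hkm.
destruct (realize_lengths (IZR d) (IZR k) (IZR m)) as
  (A & B & C & D & T & OS & Hb & Ha & Hc & Hr & HAD & HDC);
  try (rewrite <- ?mult_IZR; apply IZR_lt; assumption).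
exists A, B, C, D.
assert (P : parametrized A B C D d k m).
{ unfold parametrized.
  rewrite !mult_IZR, !minus_IZR, !IZR_sqr, IZR_cube.
  repeat split; assumption. }
split; [|exact P].
destruct P as (Zb & Za & Zc & Zr & _ & _).
assert (XB : cross_at A B C <> 0) by (unfold triangle, cross_at in *; lra).
assert (XA : cross_at B A C <> 0) by (unfold triangle, cross_at in *; lra).
destruct (cross_at_pdist_gt0 _ _ _ XB) as [PA PC].
destruct (cross_at_pdist_gt0 _ _ _ XA) as [_ PB].
split; [|split; [|split; [split|]]].
- split; [exact T|split; [|split]]; eexists; eassumption.
- apply IZR_lt in Pd, Pk, Pm, L1, L2.
  rewrite mult_IZR in L2.
  set (x := IZR m / (2 * IZR k)).
  assert (Em : IZR m = 2 * IZR k * x) by (unfold x; field; lra).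
  rewrite (angle_of_sides A B C (2 * x ^ 2 - 1)), (angle_of_sides B A C x),
    acos_double; try lra; try nra;
    rewrite ?(pdist_sym B A), ?(pdist_sym A C), ?Ha, ?Hb, ?Hc;
    try (rewrite Em; ring).
  rewrite <- ?Hc; rewrite pdist_sym; lra.
- exact OS.
- apply IZR_lt in Pd, Pk, Pm, L1, L2.
  rewrite mult_IZR in L2.
  set (x := IZR m / (2 * IZR k)).
  assert (Em : IZR m = 2 * IZR k * x) by (unfold x; field; lra).
  assert (Pr : 0 < pdist B D).
  { rewrite Hr; repeat apply Rmult_lt_0_compat; nra. }
  rewrite (angle_of_sides A B D x), (angle_of_sides D B C x); try lra;
    rewrite ?(pdist_sym B A), ?Ha, ?Hb, ?Hc, ?Hr, ?HAD, ?HDC, Em; ring.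
- eexists; eassumption.
Qed.

Theorem mainTheorem2 :
  (forall A B C D : point,
     integral_bisected_triangle A B C D ->
     exists d k m : Z, admissible d k m /\ parametrized A B C D d k m) /\
  (forall d k m : Z,
     admissible d k m ->
     exists A B C D : point,
       integral_bisected_triangle A B C D /\ parametrized A B C D d k m).
Proof.
exact (conj integral_bisected_triangle_parametrized admissible_realized).
Qed.
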